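(* Let $n\ge 2$. The restriction of the mapping $\Phi$ to the set of tree interval posets with $n$ minimal elements is a bijection onto the set of non-crossing dissections of the convex $(n+1)$-gon in which no quadrilateral is present. Consequently, these two sets have the same size.
   Context: Intervals and interval posets. For $\pi\in\mathcal{S}_n$, an interval of $\pi$ is a nonempty set of consecutive values $[a,b]=\{a,a+1,\dots,b\}\subseteq\{1,\dots,n\}$ that appear in consecutive positions of $\pi$ (in some order); $\{1,\dots,n\}$ and all singletons are intervals. The interval poset $P(\pi)$ is the set of all intervals of $\pi$ ordered by inclusion; its minimal elements are the $n$ singletons. An interval poset with $n$ minimal elements is a poset of the form $P(\pi)$ with $\pi\in\mathcal{S}_n$; it is regarded as a concrete family of subsets $[a,b]$ of $\{1,\dots,n\}$. A tree interval poset is an interval poset whose Hasse diagram (as an undirected graph) is a tree. Dissections. The vertices of the convex $(n+1)$-gon are labelled $1,\dots,n+1$ in cyclic order; $(i,j)$ denotes the segment (diagonal or outer edge) joining vertices $i$ and $j$. A dissection is a set of diagonals of the polygon. Two diagonals cross if they intersect at an interior point; a dissection is non-crossing if no two of its diagonals cross. The graph of the dissection has the polygon's vertices as vertex set, and its edges are the outer edges together with the diagonals of the dissection. A quadrilateral of the dissection is a set of four vertices $a<b<c<d$ such that $(a,b),(b,c),(c,d),(a,d)$ are all edges of the graph of the dissection but neither $(a,c)$ nor $(b,d)$ is. The map $\Phi$. For an interval poset $P$ with $n$ minimal elements, $\Phi(P)$ is the dissection of the convex $(n+1)$-gon consisting of the diagonals $(a,b+1)$ for all non-singleton intervals $[a,b]\in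 P$ (the interval $[1,n]$ gives the outer edge $(1,n+1)$, and singletons $\{a\}$ correspond to the outer edges $(a,a+1)$). *)

(* Defs.v *)
From HB Require Import structures.
From mathcomp Require Import all_boot all_order all_algebra all_fingroup.
From mathcomp Require Import boolp.

Set Implicit Arguments.
Unset Strict Implicit.
Unset Printing Implicit Defensive.

Import Order.TTheory GRing.Theory Num.Theory.
Local Open Scope ring_scope.

(* All labels are shifted down by one: values and positions of permutations   *)
(* range over {0, .., n-1} and polygon vertices over {0, .., n}.              *)

Definition irange (n : nat) (a b : 'I_n) : {set 'I_n} :=
  [set x : 'I_n | (a <= x <= b)%N].

Definition consecutive (n : nat) (A : {set 'I_n}) : bool :=
  [exists a : 'I_n, [exists b : 'I_n, (a <= b)%N && (A == irange a b)]].

(* s i is the value at position i, so s @^-1: A is the set of the positions   *)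
(* occupied by the values in A.                                               *)
Definition is_interval (n : nat) (s : 'S_n) (A : {set 'I_n}) : bool :=
  consecutive A && consecutive (s @^-1: A).

Definition interval_poset (n : nat) (s : 'S_n) : {set {set 'I_n}} :=
  [set A : {set 'I_n} | is_interval s A].

Definition covers (T : finType) (P : {set {set T}}) (A B : {set T}) : bool :=
  [&& A \in P, B \in P, A \proper B
    & ~~ [exists C in P, (A \proper C) && (C \proper B)]].

Definition hasse (T : finType) (P : {set {set T}}) : rel {set T} :=
  fun A B => covers P A B || covers P B A.

(* For a symmetric irreflexive e; ucycle e c means that c lists the pairwise  *)
(* distinct vertices of a closed e-walk, which is a graph cycle as soon as it *)
(* has at least three vertices.                                               *)
Definition is_tree (T : finType) (V : {set T}) (e : rel T) : Prop :=
  [/\ V != set0,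
      {in V &, forall x y,
        connect [rel u w | [&& u \in V, w \in V & e u w]] x y}
    & forall c : seq T,
        {subset c <= V} -> ucycle e c -> (size c <= 2)%N].

Definition tree_interval_posets (n : nat) : {set {set {set 'I_n}}} :=
  [set P : {set {set 'I_n}} |
    [exists s : 'S_n, P == interval_poset s] && `[< is_tree P (hasse P) >]].

Definition segment (m : nat) (i j : 'I_m) : {set 'I_m} := [set i; j].

Definition outer_edges (m : nat) : {set {set 'I_m}} :=
  [set segment i (ordS i) | i : 'I_m].

Definition diagonals (m : nat) : {set {set 'I_m}} :=
  [set d : {set 'I_m} | (#|d| == 2) && (d \notin outer_edges m)].

Definition dissection_graph (m : nat) (D : {set {set 'I_m}}) :
  {set {set 'I_m}} := outer_edges m :|: D.

Definition quadrilateral (m : nat) (D : {set {set 'I_m}}) (a b c d : 'I_m) :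
  bool :=
  let E := dissection_graph D in
  [&& (a < b)%N, (b < c)%N, (c < d)%N,
      segment a b \in E, segment b c \in E, segment c d \in E,
      segment a d \in E, segment a c \notin E & segment b d \notin E].

Definition quad_free (m : nat) (D : {set {set 'I_m}}) : Prop :=
  forall a b c d : 'I_m, ~~ quadrilateral D a b c d.

(* Twice the signed area of the triangle p q r.                               *)
Definition orient (R : realFieldType) (p q r : 'rV[R]_2) : R :=
  (q 0 0 - p 0 0) * (r 0 1 - p 0 1) - (q 0 1 - p 0 1) * (r 0 0 - p 0 0).

(* v enumerates the vertices of a strictly convex polygon in cyclic order:    *)
(* all increasing triples of vertices turn the same way (clockwise or         *)
(* counterclockwise), and no three vertices are collinear.                    *)
Definition convex_polygon (R : realFieldType) (m : nat)
    (v : 'I_m -> 'rV[R]_2) : Prop :=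
  (forall i j k : 'I_m, (i < j < k)%N -> 0 < orient (v i) (v j) (v k)) \/
  (forall i j k : 'I_m, (i < j < k)%N -> orient (v i) (v j) (v k) < 0).

(* p lies on the segment s of the polygon v, strictly between its endpoints.  *)
Definition in_open_segment (R : realFieldType) (m : nat)
    (v : 'I_m -> 'rV[R]_2) (s : {set 'I_m}) (p : 'rV[R]_2) : Prop :=
  exists (i j : 'I_m) (t : R),
    [/\ i != j, s = segment i j, 0 < t < 1 & p = (1 - t) *: v i + t *: v j].

Definition cross (R : realFieldType) (m : nat) (v : 'I_m -> 'rV[R]_2)
    (d e : {set 'I_m}) : Prop :=
  d != e /\ exists p, in_open_segment v d p /\ in_open_segment v e p.

Definition noncrossing (R : realFieldType) (m : nat) (v : 'I_m -> 'rV[R]_2)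
    (D : {set {set 'I_m}}) : Prop :=
  {in D &, forall d e, ~ cross v d e}.

Definition nc_quad_free_dissections (R : realFieldType) (m : nat)
    (v : 'I_m -> 'rV[R]_2) : {set {set {set 'I_m}}} :=
  [set D : {set {set 'I_m}} |
    (D \subset diagonals m) && `[< noncrossing v D /\ quad_free D >]].

(* The values of widen_ord _ a and lift ord0 b are a and b + 1. Intersecting  *)
(* with the diagonals discards only the outer edge given by the full interval. *)
Definition Phi (n : nat) (P : {set {set 'I_n}}) : {set {set 'I_n.+1}} :=
  diagonals n.+1 :&:
  [set d | [exists a : 'I_n, [exists b : 'I_n,
     [&& (a < b)%N, irange a b \in P
       & d == segment (widen_ord (leqnSn n) a) (lift ord0 b)]]]].

(* Main.v *)
Require Import Defs.
From mathcomp Require Import all_boot all_order all_algebra all_fingroup.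
From mathcomp Require Import boolp zify ring lra.

Set Implicit Arguments.
Unset Strict Implicit.
Unset Printing Implicit Defensive.

(** An edge (a, b) of the graph of a dissection encodes the half-open interval
    of values {a, .., b-1}: the sides (a, a+1) encode the singletons and the
    side (0, n) the full set. With this dictionary [edge_Phi] says that the
    intervals in P are exactly the edges of the graph of Phi P, so P can be
    read off from Phi P and injectivity is immediate.

    Two diagonals cross iff their end points alternate ([crossP]), that is, iff
    the corresponding intervals overlap without being nested. In an interval
    poset, the intersection and the union of two overlapping intervals A and B
    are again intervals, and the saturated chains from the intersection to the
    union through A and through B close up to a cycle of the Hasse diagram.
    Conversely, in a laminar family no element has two upper covers, so the
    Hasse diagram is a tree rooted at the full set. Hence tree interval posets
    are those with a non-crossing image ([tree_laminar], [laminar_tree]).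

    A quadrilateral would consist of three consecutive blocks of values, each an
    interval, whose union is an interval. Whatever the order of the three blocks
    in the permutation, the block in the middle position is adjacent in value to
    one of the other two, and their union is an interval, which provides one of
    the two missing edges ([three_blocks]).

    For surjectivity, a non-crossing quadrilateral-free dissection is read as a
    rooted tree: the nodes are the edges of its graph, and the children of
    (a, b) are the other sides of the polygonal cell below (a, b). Every inner
    node has k >= 2 children, and k is not 3. The permutation is obtained by
    inflation: the k children are ordered by a permutation in which no interval
    of at least two children other than the full one occurs at consecutive
    positions, which exists precisely for k different from 3
    ([simple_key_exists]). A final part of one child and an initial part of the
    next one could still form a spurious interval, as in the identity
    permutation. This is prevented by alternating orientations along the tree:
    the relative order of the two extreme elements of a child is opposite to
    that of the two extreme elements of its parent ([node_inflation]). The order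
    is described by numerical keys r : nat -> nat, converted to a permutation by
    ranking ([perm_of_keys]). *)

(** * Simple permutations *)

(** For k >= 4 the key describes a simple permutation, with a prescribed
    relative position of the first and last entries; reversing the order of the
    keys switches between the two orientations. For k = 2 the last clause is
    void, and for k = 3 no such key exists. *)
Lemma simple_key_exists (k : nat) (eps : bool) : 2 <= k -> k != 3 ->
  exists key : nat -> nat,
  [/\ forall i j, i < k -> j < k -> key i = key j -> i = j,
      (key 0 < key k.-1) = eps
    & forall i j, i < j -> j < k -> (0 < i) || (j < k.-1) ->
      exists p q l, [/\ i <= p <= j, i <= q <= j, l < k, ~~ (i <= l <= j)
                      & key p < key l < key q] ].
Proof.
move=> k2 k3.
(* The odd numbers come first, then the even ones: an interval with at least  *)
(* two elements straddles the junction of the two halves. When k is odd, the  *)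
(* last number k-1 is even and goes right after 0, so that {0, .., k-2} is    *)
(* not an interval either.                                                    *)
pose f x := if odd x then x else if x == k.-1 then k.+1 else k + x.*2.
have finj i j : i < k -> j < k -> f i = f j -> i = j.
  by rewrite /f; case oi: (odd i); case oj: (odd j); do ?[case: eqP => ?]; lia.
have f_simple i j : i < j -> j < k -> (0 < i) || (j < k.-1) ->
    exists p q l, [/\ i <= p <= j, i <= q <= j, l < k, ~~ (i <= l <= j)
                    & f p < f l < f q].
  move=> ij jk prop.
  have [i0|i0] := posnP i; last first.
    have [o [e [Ho He oo ee]]] : exists o e,
        [/\ i <= o <= j, i <= e <= j, odd o & ~~ odd e].
      case oi: (odd i); [exists i, i.+1 | exists i.+1, i];
        by split; rewrite /= ?oi //; lia.
    exists o, e, 0; split=> //; rewrite ?/f ?oo ?(negbTE ee) /=; try lia.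
    by do ?[case: eqP => ?]; lia.
  subst i; rewrite /= in prop.
  have [jk2|jk2] := ltnP j k.-2.
    case ok: (odd k); [exists 1, 0, k.-2 | exists 1, 0, k.-1];
      split; try lia; rewrite /f /=.
      by rewrite (_ : odd k.-2 = true); [case: eqP | ]; lia.
    by rewrite (_ : odd k.-1 = true); [case: eqP | ]; lia.
  have jE : j = k.-2 by lia.
  case ok: (odd k).
    exists 0, 2, k.-1; split; try lia.
    rewrite /f /= (_ : odd k.-1 = false) ?eqxx; last by lia.
    by do ?[case: eqP => ?]; lia.
  exists 1, 0, k.-1; split; try lia.
  rewrite /f /= (_ : odd k.-1 = true); last by lia.
  by do ?[case: eqP => ?]; lia.
have [fE|fNE] := eqVneq (f 0 < f k.-1) eps; first by exists f.
have flt x : x < k -> f x < 3 * k.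
  by rewrite /f; case: ifP => ?; do ?[case: eqP => ?]; lia.
exists (fun x => 3 * k - f x); split.
- move=> i j ik jk; have := flt _ ik; have := flt _ jk => ? ? ?.
  by apply: finj => //; lia.
- have := @finj 0 k.-1; have := flt 0; have := flt k.-1; move: fNE.
  by case: eps; lia.
move=> i j ij jk prop; have [p [q [l [Hp Hq Hl Hl' Hk]]]] := f_simple i j ij jk prop.
exists q, p, l; split=> //; have := flt p; have := flt q; have := flt l; lia.
Qed.

Lemma discrete_ivt (f : nat -> nat) (a b p : nat) :
  a <= b -> (forall x, a <= x < b -> f x.+1 <= (f x).+1) ->
  f a <= p <= f b -> exists2 x, a <= x <= b & f x = p.
Proof.
move=> ab; rewrite -(subnKC ab); elim: (b - a) => [|m IHm] step Hp.
  by exists a; move: Hp; rewrite ?addn0; lia.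
have [pm|pm] := leqP p (f (a + m)).
  have [||x Hx fx] := IHm; last by exists x => //; lia.
    by move=> x Hx; apply: step; lia.
  by lia.
exists (a + m.+1); first by lia.
by have := step (a + m); rewrite addnS in Hp *; lia.
Qed.

(** * The cells of a non-crossing dissection *)

(** The graph of a non-crossing quadrilateral-free dissection of the polygon
    with vertices 0, .., n, each edge being given by its end points in
    increasing order. *)
Record edge_system (n : nat) (E : rel nat) : Prop := EdgeSystem {
  edge_bounds : forall a b, E a b -> a < b <= n;
  edge_side : forall a, a < n -> E a a.+1;
  edge_full : E 0 n;
  edge_noncrossing : forall a b c d, E a b -> E c d -> a < c -> c < b -> ~~ (b < d);
  edge_quad_free : forall a b c d,
    E a b -> E b c -> E c d -> E a d -> E a c || E b d }.

(** The vertices, other than a and b, of the cell below the edge (a, b). *)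
Definition cut (E : rel nat) (a b w : nat) : bool :=
  `[< a < w < b /\ forall c d, E c d -> a <= c -> d <= b -> c < w < d ->
        c = a /\ d = b >].

(** The sides of the cell below (a, b) are found greedily: an edge under which
    the end of the longest edge from u lies would have to cross that edge, pass
    over u, or start at u and be longer. *)
Lemma longest_edge_ends_at_cut (n : nat) (E : rel nat) (a b u : nat) :
  edge_system n E -> E a b -> a.+1 < b ->
  a <= u < b -> u = a \/ cut E a b u ->
  exists e, [/\ E u e, e <= b, (u, e) <> (a, b) & e = b \/ cut E a b e].
Proof.
move=> ES Eab ab aub Hu.
have bn := edge_bounds ES Eab.
pose Q e := E u e && (e <= b) && ((u, e) != (a, b)).
have exQ : exists e, Q e.
  exists u.+1; rewrite /Q (edge_side ES) /=; last by lia.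
  by apply/andP; split; [|apply/eqP=> -[]]; lia.
have boundQ e : Q e -> e <= b by case/andP => /andP[].
case: (ex_maxnP exQ boundQ) => e /andP[/andP[Eue eb] Hue] emax.
have ue := edge_bounds ES Eue.
move/eqP in Hue; exists e; split=> //.
have [->|eb'] := eqVneq e b; [by left | right].
apply/asboolP; split; first by lia.
move=> f g Efg af gb feg.
have [fu|fu] := ltnP u f.
  by have := edge_noncrossing ES Eue Efg fu; lia.
have [fu'|uf] := ltnP f u.
  have [ua|/asboolP[_ /(_ f g Efg af gb)]] := Hu; first by lia.
  by apply; lia.
have fE : f = u by lia.
subst f; have [[-> ->] //|Hug] := eqVneq (u, g) (a, b).
by have := emax g; rewrite /Q Efg gb Hug => /(_ isT); lia.
Qed.

Lemma edge_between_cuts (n : nat) (E : rel nat) (a b u w : nat) :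
  edge_system n E -> E a b -> a.+1 < b ->
  a <= u -> u < w -> w <= b -> u = a \/ cut E a b u ->
  w = b \/ cut E a b w -> (forall x, u < x < w -> ~~ cut E a b x) ->
  E u w.
Proof.
move=> ES Eab ab au uw wb Hu Hw Hno.
have [|e [Eue eb Hne He]] := longest_edge_ends_at_cut ES Eab ab _ Hu; first by lia.
have ue := edge_bounds ES Eue.
have [ew|ew|<- //] := ltngtP e w.
- case: He => [eb'|ce]; first by lia.
  by have := Hno e; rewrite ce; lia.
- case: Hw => [wb'|/asboolP[_ /(_ u e Eue au eb)]]; first by lia.
  by rewrite uw ew => /(_ isT)[ua eb']; case: Hne; rewrite ua eb'.
Qed.

(** The children of (a, b) are numbered from left to right, and idx maps a value
    x of {a, .., b-1} to the number of the child that contains it. An interval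
    of values is contained in a child iff idx agrees at its extreme elements. *)
Record node_children (E : rel nat) (a b k : nat) (idx : nat -> nat) : Prop :=
  NodeChildren {
  idx_first : idx a = 0;
  idx_last : idx b.-1 = k.-1;
  idx_mono : forall x y, a <= x -> x <= y -> y < b -> idx x <= idx y;
  idx_step : forall x, a <= x -> x.+1 < b -> idx x.+1 <= (idx x).+1;
  idx_fibre : forall i, i < k -> exists u w,
    [/\ E u w, a <= u, w <= b, (u, w) <> (a, b)
      & forall x, a <= x < b -> (idx x == i) = (u <= x < w)];
  idx_edge : forall c d, E c d -> a <= c -> d <= b -> (c, d) <> (a, b) ->
    idx c = idx d.-1 }.

(** The number of the child that contains x is the number of cuts in
    {a+1, .., x}. The case of three children is excluded because a cell with
    four sides is a quadrilateral: an additional edge between its vertices would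
    join two different children. *)
Lemma node_children_exist (n : nat) (E : rel nat) (a b : nat) :
  edge_system n E -> E a b -> a.+1 < b ->
  exists k idx, [/\ 2 <= k, k != 3 & node_children E a b k idx].
Proof.
move=> ES Eab ab.
pose idx x := count (cut E a b) (index_iota a.+1 x.+1).
have idxS x : a <= x -> idx x.+1 = idx x + cut E a b x.+1.
  move=> ax; rewrite /idx /index_iota.
  rewrite (_ : x.+2 - a.+1 = x.+1 - a.+1 + 1); last by lia.
  by rewrite iotaD count_cat /= addn0 (_ : a.+1 + (x.+1 - a.+1) = x.+1); last by lia.
have idx0 : idx a = 0 by rewrite /idx /index_iota subnn.
have mono x y : a <= x -> x <= y -> idx x <= idx y.
  move=> ax /subnKC <-; elim: (y - x) => [|m IH]; first by rewrite addn0.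
  by rewrite addnS idxS; lia.
pose k := (idx b.-1).+1.
have no_cutP x y : a <= x -> x <= y -> idx x = idx y ->
    forall w, x < w <= y -> ~~ cut E a b w.
  move=> ax xy e w Hw; apply/negP => cw.
  have := idxS w.-1; rewrite prednK; last by lia.
  rewrite cw; have := @mono x w.-1; have := @mono w y; lia.
have edge_idx c d : E c d -> a <= c -> d <= b -> (c, d) <> (a, b) ->
    idx c = idx d.-1.
  move=> Ecd ac db Hne; have := edge_bounds ES Ecd => /andP[cd _].
  have : forall m, c + m < d -> idx (c + m) = idx c.
    elim=> [|m IH] Hm; first by rewrite addn0.
    rewrite addnS idxS; last by lia.
    rewrite IH; last by lia.
    rewrite (_ : cut _ _ _ _ = false) ?addn0 //; apply/negbTE/asboolP.
    case=> _ /(_ c d Ecd ac db) H; apply: Hne.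
    by case: H => [|-> -> //]; lia.
  by move=> /(_ (d.-1 - c)) H; rewrite -H; [congr idx|]; lia.
have k2 : 2 <= k.
  have [||e [Eae eb Hne [eb'|ce]]] := @longest_edge_ends_at_cut n E a b a ES Eab ab.
  - by lia.
  - by left.
  - by rewrite eb' in Hne.
  rewrite /k ltnS lt0n; apply/eqP => idxb.
  have Hce : a < e < b by case/asboolP: (ce).
  have := @no_cutP a b.-1; rewrite idx0 idxb.
  by move=> /(_ _ _ _ e); rewrite ce; lia.
have fibre i : i < k -> exists u w,
    [/\ E u w, a <= u, w <= b, (u, w) <> (a, b)
      & forall x, a <= x < b -> (idx x == i) = (u <= x < w)].
  move=> ik.
  have [|||x0 Hx0 idx_x0] := @discrete_ivt idx a b.-1 i.
  - by lia.
  - by move=> x Hx; rewrite idxS; lia.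
  - by rewrite idx0; lia.
  pose Q x := (a <= x < b) && (idx x == i).
  have exQ : exists x, Q x by exists x0; rewrite /Q idx_x0 eqxx; lia.
  have boundQ x : Q x -> x <= b by case/andP; lia.
  case: (ex_minnP exQ) => u /andP[Hu /eqP idxu] umin.
  case: (ex_maxnP exQ boundQ) => w /andP[Hw /eqP idxw] wmax.
  have uw : u <= w by apply: umin; rewrite /Q Hw idxw eqxx.
  exists u, w.+1.
  have Hne : (u, w.+1) <> (a, b).
    by case=> ua wb; move: idxw idxu k2; rewrite /k ua idx0 -wb /=; lia.
  split=> //; try lia; last first.
    move=> x Hx; apply/eqP/idP => [ix|Hx'].
      have := umin x; have := wmax x; rewrite /Q ix eqxx Hx /=; lia.
    by have := @mono u x; have := @mono x w; lia.
  apply: (edge_between_cuts ES Eab ab) => //; try lia.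
  - have [->|ua] := eqVneq u a; [by left|right].
    apply/negPn/negP => Hc; have := idxS u.-1; rewrite prednK; last by lia.
    rewrite (negbTE Hc); have := umin u.-1; rewrite /Q; lia.
  - have [->|wb] := eqVneq w.+1 b; [by left|right].
    apply/negPn/negP => Hc; have := idxS w.
    rewrite (negbTE Hc); have := wmax w.+1; rewrite /Q; lia.
  - by move=> x Hx; apply: (@no_cutP u w) => //; lia.
have k3 : k != 3.
  apply/eqP => k3.
  have [|u0 [w0 [E0 au0 wb0 _ H0]]] := fibre 0; first by lia.
  have [|u1 [w1 [E1 au1 wb1 _ H1]]] := fibre 1; first by lia.
  have [|u2 [w2 [E2 au2 wb2 _ H2]]] := fibre 2; first by lia.
  have idxb : idx b.-1 = 2 by move: k3; rewrite /k; lia.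
  have B0 := edge_bounds ES E0; have B1 := edge_bounds ES E1.
  have B2 := edge_bounds ES E2.
  have e0 : u0 = a by have := H0 a; rewrite idx0; lia.
  have e2 : w2 = b by have := H2 b.-1; rewrite idxb; lia.
  have adjacent i u w u' w' : u < w -> a <= u -> w <= b ->
      u' < w' -> a <= u' -> w' <= b ->
      (forall x, a <= x < b -> (idx x == i) = (u <= x < w)) ->
      (forall x, a <= x < b -> (idx x == i.+1) = (u' <= x < w')) -> w = u'.
    move=> uw au wb uw' au' wb' H H'.
    have iu : idx u = i by apply/eqP; rewrite H; lia.
    have iu' : idx u' = i.+1 by apply/eqP; rewrite H'; lia.
    have uu' : u < u' by rewrite ltnNge; apply/negP => /(mono _ _ au'); lia.
    have wu' : w <= u'.
      by rewrite leqNgt; apply/negP => u'w; have := H u'; rewrite iu'; lia.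
    apply/eqP; rewrite eqn_leq wu' leqNgt; apply/negP => w_lt.
    have aw : a <= w by lia.
    have := mono w u' aw wu'; have := mono u w au (ltnW uw).
    have := H w; have := H' w; rewrite iu iu'; clear -w_lt aw uw wb' uw'; lia.
  have e1 : w0 = u1 by apply: (adjacent 0 u0 w0 u1 w1) => //; lia.
  have e3 : w1 = u2 by apply: (adjacent 1 u1 w1 u2 w2) => //; lia.
  subst u0 w2 w0 w1.
  have /orP[Eu|Eu] := edge_quad_free ES E0 E1 E2 Eab.
  - have : idx a = idx u2.-1 by apply: edge_idx => //; case; lia.
    by rewrite idx0 => i0; have := H1 u2.-1; rewrite -i0; lia.
  - have : idx u1 = idx b.-1 by apply: edge_idx => //; case; lia.
    by rewrite idxb => i2; have := H1 u1; rewrite i2; lia.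
exists k, idx; split=> //; split=> //.
- by move=> x y *; apply: mono.
- by move=> x *; rewrite idxS //; case: cut; lia.
Qed.

(** * An order whose intervals are prescribed *)

Definition order_convex (r : nat -> nat) (a b c d : nat) : Prop :=
  forall x y z, c <= x < d -> c <= y < d -> a <= z < b ->
    r x < r z < r y -> c <= z < d.

(** Besides realising the edges under (a, b) as the intervals of the order given
    by r, the two extreme elements are required to be in the relative position
    eps; the inflation of the parent node relies on it. *)
Definition realises (E : rel nat) (a b : nat) (eps : bool) (r : nat -> nat) :=
  [/\ forall x y, a <= x < b -> a <= y < b -> r x = r y -> x = y,
      forall c d, a <= c -> c < d -> d <= b -> order_convex r a b c d <-> E c d
    & a.+1 < b -> (r a < r b.-1) = eps].

(** Elements are compared first by the key of their child, then inside the
    child. If an interval meets several children, simplicity of the key forces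
    it to meet all of them. If it is not the whole node, then it misses the
    outer end of an extreme child. Since the orientation of this child is
    opposite to that of the node, the missing end lies, in the order, between
    the inner end of the child and the elements of the other extreme child,
    which both belong to the interval. *)
Lemma node_inflation (n : nat) (E : rel nat) (a b k : nat) (idx key rho : nat -> nat)
    (eps : bool) :
  edge_system n E -> a.+1 < b -> E a b -> node_children E a b k idx -> 2 <= k ->
  (forall i j, i < k -> j < k -> key i = key j -> i = j) ->
  (key 0 < key k.-1) = eps ->
  (forall i j, i < j -> j < k -> (0 < i) || (j < k.-1) ->
      exists p q l, [/\ i <= p <= j, i <= q <= j, l < k, ~~ (i <= l <= j)
                      & key p < key l < key q]) ->
  (forall u w, E u w -> a <= u -> w <= b -> (u, w) <> (a, b) ->
     (forall x, a <= x < b -> (idx x == idx u) = (u <= x < w)) ->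
     realises E u w (~~ eps) rho) ->
  exists r, realises E a b eps r.
Proof.
move=> ES ab Eab [idxa idxb mono step fibre edge_idx] k2 key_inj key_eps key_simple
  child.
(* B bounds rho on the node, so that r is ordered lexicographically.          *)
pose B := (\sum_(x < b) rho x).+1.
have rhoB x : x < b -> rho x < B.
  by move=> xb; rewrite ltnS (bigD1 (Ordinal xb)) //= leq_addr.
pose r x := key (idx x) * B + rho x.
have ltk x : a <= x < b -> idx x < k.
  move=> Hx; have := mono x b.-1; lia.
have r_key x y : x < b -> key (idx x) < key (idx y) -> r x < r y.
  by move=> /rhoB Hx Hk; rewrite /r; nia.
have r_rho x y : idx x = idx y -> (r x < r y) = (rho x < rho y).
  by rewrite /r => ->; rewrite ltn_add2l.
have r_le x y : y < b -> r x < r y -> key (idx x) <= key (idx y).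
  by move=> yb rxy; rewrite leqNgt; apply/negP => /(r_key _ _ yb); lia.
have r_between x y z i : a <= x < b -> a <= y < b -> a <= z < b ->
    idx x = i -> idx y = i -> r x < r z < r y -> idx z = i.
  move=> Hx Hy Hz ix iy /andP[xz zy].
  apply: key_inj; try by [apply: ltk | rewrite -ix ltk].
  have := r_le x z; have := r_le z y; rewrite ix iy; lia.
have childP x : a <= x < b -> exists u w, [/\ u <= x < w, a <= u, w <= b,
    E u w & realises E u w (~~ eps) rho] /\ 
    forall y, a <= y < b -> (idx y == idx x) = (u <= y < w).
  move=> Hx; have [u [w [Euw au wb Hne H]]] := fibre _ (ltk x Hx).
  have Hux : u <= x < w by rewrite -H.
  exists u, w; split=> //; split=> //; apply: child => // y Hy.
  by rewrite -H // (_ : idx u = idx x) //; apply/eqP; rewrite H; lia.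
have r_inj x y : a <= x < b -> a <= y < b -> r x = r y -> x = y.
  move=> Hx Hy; have [e|ne] := eqVneq (idx x) (idx y).
    have [u [w [[Hux _ _ _ [inj _ _]] H]]] := childP x Hx.
    rewrite /r e => /addnI; apply: inj => //.
    by rewrite -H // e.
  have := r_key x y; have := r_key y x; have := key_inj (idx x) (idx y).
  have := ltk x Hx; have := ltk y Hy; lia.
have r_ends x y : a <= x < b -> a <= y < b -> idx x = 0 -> idx y = k.-1 ->
    (r x < r y) = eps /\ (r y < r x) = ~~ eps.
  move=> Hx Hy ix iy; have := r_key x y; have := r_key y x; rewrite ix iy.
  by have := key_inj 0 k.-1; move: key_eps; case: (eps); lia.
exists r; split => //; last first.
  by move=> _; have [||||-> //] := @r_ends a b.-1; try lia.
move=> c d ac cd db.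
  have [[-> ->]|ne] := eqVneq (c, d) (a, b); first by split=> // _ x y z.
  have idx_cd x : c <= x < d -> idx c <= idx x <= idx d.-1.
    by move=> Hx; rewrite !mono; lia.
  have [e|ne_idx] := eqVneq (idx c) (idx d.-1).
    (* The interval lies in one child, where rho decides.                      *)
    have [|u [w [[Hux au wb Euw [_ cvx _]] H]]] := childP c; first by lia.
    have Hcd x : c <= x < d -> idx x = idx c.
      by move=> Hx; have := idx_cd x Hx; lia.
    have Huw x : c <= x < d -> u <= x < w.
      by move=> Hx; rewrite -H ?Hcd //; lia.
    have idx_uw x : u <= x < w -> idx x = idx c.
      by move=> Hx; apply/eqP; rewrite H //; lia.
    rewrite -(cvx c d); [|by lia..|by have := Huw d.-1; lia].
    split=> Hcv x y z Hx Hy Hz Hxyz.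
      apply: (Hcv x y z) => //; first by lia.
      by rewrite !r_rho ?idx_uw //; apply: Huw.
    have iz : idx z = idx c.
      by apply: (r_between x y) => //; rewrite ?Hcd //; lia.
    apply: (Hcv x y z) => //; first by rewrite -H ?iz.
    by rewrite -!r_rho // ?iz ?Hcd.
  (* Otherwise it meets several children: it is not an edge, and it must be    *)
  (* shown not to be convex.                                                   *)
  split=> [Hcv|/edge_idx H]; last first.
    by case/eqP: ne_idx; apply: H => //; apply/eqP.
  have idx_lt : idx c < idx d.-1 by have := idx_cd c; lia.
  have pick p : idx c <= p <= idx d.-1 -> exists2 x, c <= x < d & idx x = p.
    move=> Hp; have [|x|x Hx <-] := @discrete_ivt idx c d.-1 p _ _ Hp.
    - by lia.
    - by move=> Hx; apply: step; lia.
    - by exists x => //; lia.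
  have [prop|] := boolP ((0 < idx c) || (idx d.-1 < k.-1)).
    (* An element of a child l outside the range of children met separates     *)
    (* elements of two children met.                                           *)
    have dk : idx d.-1 < k by apply: ltk; lia.
    have [p [q [l [Hp Hq lk Hl Hk]]]] := key_simple _ _ idx_lt dk prop.
    have [x Hx ix] := pick p Hp; have [y Hy iy] := pick q Hq.
    have [u [w [Euw au wb _ H]]] := fibre l lk.
    have uw : u < w by have := edge_bounds ES Euw; lia.
    have iu : idx u = l by apply/eqP; rewrite H; lia.
    have := Hcv x y u Hx Hy; rewrite !r_key ?ix ?iy ?iu //; try lia.
    by move=> /(_ _ isT) => Hu; have := idx_cd u; lia.
  rewrite negb_or -!leqNgt leqn0 => /andP[/eqP ic id].
  have id' : idx d.-1 = k.-1 by have := ltk d.-1; lia.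
  (* All children are met, and an extreme one is truncated: the first child if *)
  (* a < c, the last one if d < b.                                             *)
  have [ca|ca] := ltnP a c.
    have [|u [w [[Hux au wb Euw [_ _ ori]] H]]] := childP a; first by lia.
    have ua : u = a by lia.
    subst u; have Hc : a <= c < w by rewrite -H ?ic ?idxa //; lia.
    have Hw : idx w.-1 = 0 by apply/eqP; rewrite -idxa H; lia.
    have Hwd : w <= d.-1.
      rewrite leqNgt; apply/negP => dw.
      by have := H d.-1; rewrite id' idxa; lia.
    have {}ori : (r a < r w.-1) = ~~ eps.
      by rewrite r_rho ?idxa ?Hw //; apply: ori; lia.
    have [||||r1 r2] := @r_ends a d.-1; try lia.
    have := Hcv w.-1 d.-1 a; have := Hcv d.-1 w.-1 a; have := @r_inj a w.-1.
    by move: r1 r2 ori; case: (eps); lia.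
  have [db'|bd] := ltnP d b; last by case/eqP: ne; congr pair; lia.
  have [|u [w [[Hux au wb Euw [_ _ ori]] H]]] := childP b.-1; first by lia.
  have wE : w = b by lia.
  subst w; have Hu : idx u = k.-1 by apply/eqP; rewrite -idxb H; lia.
  have Hd : u <= d.-1 by have := H d.-1; rewrite id' idxb; lia.
  have Hcu : c < u.
    by rewrite ltnNge; apply/negP => uc; have := H c; rewrite ic idxb; lia.
  have {}ori : (r u < r b.-1) = ~~ eps.
    by rewrite r_rho ?idxb ?Hu //; apply: ori; lia.
  have [||||r1 r2] := @r_ends c b.-1; try lia.
  have := Hcv c u b.-1; have := Hcv u c b.-1; have := @r_inj u b.-1.
  by move: r1 r2 ori; case: (eps); lia.
Qed.

Lemma realisation_exists (n : nat) (E : rel nat) (a b : nat) (eps : bool) :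
  edge_system n E -> E a b -> exists r, realises E a b eps r.
Proof.
move=> ES; have [m] := ubnP (b - a); elim: m a b eps => // m IHm a b eps Hm Eab.
have Hab := edge_bounds ES Eab.
have [ab|ab] := ltnP a.+1 b; last first.
  exists (fun _ => 0); split; try by move=> *; lia.
  move=> c d ac cd db; have [-> ->] : c = a /\ d = b by lia.
  by split=> // _ x y z; lia.
have [k [idx [k2 k3 nc]]] := node_children_exist ES Eab ab.
have [key [key_inj key_eps key_simple]] := simple_key_exists eps k2 k3.
(* A realisation is chosen for each number of a child rather than for each    *)
(* value, so that all elements of a child use the same one.                   *)
have /choice[rho Hrho] : forall i, exists r, forall u w, E u w -> a <= u ->
    w <= b -> (u, w) <> (a, b) -> idx u = i ->
    (forall x, a <= x < b -> (idx x == i) = (u <= x < w)) ->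
    realises E u w (~~ eps) r.
  move=> i; have [ik|ki] := ltnP i k; last first.
    exists id => u w Euw au wb _ iu _.
    have := edge_bounds ES Euw; have := idx_mono nc au; have := idx_last nc.
    by move=> ib /(_ b.-1); lia.
  have [u [w [Euw au wb Hne H]]] := idx_fibre nc ik.
  have uw := edge_bounds ES Euw.
  have [|r Hr] := IHm u w (~~ eps) _ Euw.
    by have : ~ (u = a /\ w = b) by [case=> *; apply: Hne; congr pair]; lia.
  exists r => u' w' Euw' au' wb' _ _ H'.
  have uw' := edge_bounds ES Euw'.
  have [-> ->] : u' = u /\ w' = w; last by [].
  have K x : a <= x < b -> (u <= x < w) = (u' <= x < w').
    by move=> Hx; rewrite -H // -H'.
  have : u' <= u < w' by rewrite -K; lia.
  have : u <= u' < w by rewrite K; lia.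
  have : u' <= w.-1 < w' by rewrite -K; lia.
  have : u <= w'.-1 < w by rewrite K; lia.
  by lia.
apply: (node_inflation (rho := fun x => rho (idx x) x) ES ab Eab nc k2
          key_inj key_eps key_simple).
move=> u w Euw au wb Hne H; have uw := edge_bounds ES Euw.
have [inj cvx ori] := Hrho (idx u) u w Euw au wb Hne erefl H.
have idxE x : u <= x < w -> idx x = idx u.
  by move=> Hx; apply/eqP; rewrite H //; lia.
split.
- by move=> x y Hx Hy; rewrite !idxE //; apply: inj.
- move=> c d uc cd dw; rewrite -cvx //.
  by split=> Hcv x y z Hx Hy Hz; have := Hcv x y z Hx Hy Hz;
     rewrite !idxE //; lia.
- by move=> Huw; rewrite !idxE ?ori //; lia.
Qed.

(** * Hasse diagrams of laminar families *)

Definition laminar (T : finType) (P : {set {set T}}) : Prop :=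
  forall A B, A \in P -> B \in P -> A :&: B != set0 ->
    (A \subset B) || (B \subset A).

Lemma covers_proper (T : finType) (P : {set {set T}}) (A B : {set T}) :
  covers P A B -> A \proper B.
Proof. by case/and4P. Qed.

Lemma saturated_chain (T : finType) (P : {set {set T}}) (A B : {set T}) :
  A \in P -> B \in P -> A \proper B ->
  exists p, [/\ path (covers P) A p, last A p = B & all [in P] p].
Proof.
have [m] := ubnP (#|B| - #|A|); elim: m A B => // m IHm A B Hm PA PB AB.
have ltAB := proper_card AB.
have [/existsP[C /andP[PC /andP[AC CB]]]|Hno] :=
    boolP [exists C in P, (A \proper C) && (C \proper B)].
  have ltAC := proper_card AC; have ltCB := proper_card CB.
  have [|p [pA pC pP]] := IHm A C _ PA PC AC; first by lia.
  have [|q [qC qB qP]] := IHm C B _ PC PB CB; first by lia.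
  by exists (p ++ q); rewrite cat_path last_cat pA pC qC qB all_cat pP qP.
by exists [:: B]; rewrite /= /covers PA PB AB Hno.
Qed.

Lemma proper_path_mem (T : finType) (L A : {set T}) (p : seq {set T}) :
  path (fun A B : {set T} => A \proper B) L p -> A \in p ->
  (L \proper A) && (A \subset last L p).
Proof.
have trp : transitive (fun A B : {set T} => A \proper B).
  by move=> B A' C; apply: proper_trans.
move=> pp Ap; case/splitPr: Ap pp => p1 p2; rewrite cat_path last_cat /= => pp.
have := pp => /and3P[_ _ /(order_path_min trp)/allP minA].
have /allP minL : all (fun B : {set T} => L \proper B) (p1 ++ A :: p2).
  by apply: order_path_min trp _; rewrite cat_path.
rewrite minL ?mem_cat ?mem_head ?orbT //=.
have := mem_last A p2; rewrite inE => /predU1P[->//|/minA/proper_sub//].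
Qed.

Lemma ucycle_of_two_paths (T : eqType) (e : rel T) (L U : T) (p q : seq T) :
  symmetric e -> path e L p -> last L p = U -> path e L (rcons q U) ->
  uniq (L :: p) -> uniq (L :: q) -> {in p, forall x, x \notin q} ->
  ucycle e (L :: p ++ rev q).
Proof.
move=> syme Hp lastp Hq /= /andP[Lp up] /andP[Lq uq] dis.
apply/andP; split.
  rewrite /= rcons_cat cat_path Hp lastp /=.
  have : path (fun x => e^~ x) L (rcons q U).
    by rewrite (eq_path (e' := e)) // => x y; apply: syme.
  by rewrite -rev_path last_rcons belast_rcons rev_cons.
rewrite /= cat_uniq up rev_uniq uq mem_cat mem_rev negb_or Lp Lq /= andbT.
by apply/hasPn => x; rewrite mem_rev; apply/contraL/dis.
Qed.

(** If A and B overlap without being nested, the chains through A and through B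
    between their intersection and their union share only their end points: a
    set strictly in between that lies on both chains would be contained in both
    A and B, contain both, or make one of them contained in the other. Together
    the chains form a cycle. *)
Lemma tree_laminar (T : finType) (P : {set {set T}}) :
  is_tree P (hasse P) ->
  (forall A B, A \in P -> B \in P -> A :&: B != set0 ->
     (A :&: B \in P) && (A :|: B \in P)) ->
  laminar P.
Proof.
move=> [_ _ acyclic] closed A B PA PB AB0.
have /andP[PL PU] := closed A B PA PB AB0.
apply/negPn/negP; rewrite negb_or => /andP[nAB nBA].
have LA : A :&: B \proper A.
  by rewrite properEneq subsetIl andbT; apply: contra nAB => /eqP/setIidPl.
have LB : A :&: B \proper B.
  by rewrite properEneq subsetIr andbT; apply: contra nBA => /eqP/setIidPr.
have AU : A \proper A :|: B.
  by rewrite properEneq subsetUl andbT eq_sym; apply: contra nBA => /eqP/setUidPl.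
have BU : B \proper A :|: B.
  by rewrite properEneq subsetUr andbT eq_sym; apply: contra nAB => /eqP/setUidPr.
have [p1 [path1 last1 P1]] := saturated_chain PL PA LA.
have [p2 [path2 last2 P2]] := saturated_chain PA PU AU.
have [p3 [path3 last3 P3]] := saturated_chain PL PB LB.
have [p4 [path4 last4 P4]] := saturated_chain PB PU BU.
have pathp : path (covers P) (A :&: B) (p1 ++ p2).
  by rewrite cat_path path1 last1.
have pathq : path (covers P) (A :&: B) (p3 ++ p4).
  by rewrite cat_path path3 last3.
have pp L p : path (covers P) L p -> path (fun C D : {set T} => C \proper D) L p.
  by apply: sub_path => C D; apply: covers_proper.
have up L p : path (covers P) L p -> uniq (L :: p).
  move=> /pp pLp.
  apply: (sorted_uniq (leT := fun C D : {set T} => C \proper D)) => //.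
    by move=> C D E; apply: proper_trans.
  by move=> C; rewrite properxx.
have [p4' p4E] : exists p, p4 = rcons p (A :|: B).
  case/lastP: p4 last4 {path4 P4 pathq} => [/= BUE|p C].
    by move: BU; rewrite -BUE properxx.
  by rewrite last_rcons => ->; exists p.
subst p4; rewrite -rcons_cat in pathq.
have U4 C : C \in p4' -> C != A :|: B.
  have := up _ _ path4; rewrite /= rcons_uniq => /and3P[_ + _] C4.
  by apply: contraNneq => <-.
have cycP : {subset (A :&: B) :: (p1 ++ p2) ++ rev (p3 ++ p4') <= P}.
  move=> C; rewrite inE !mem_cat mem_rev mem_cat => /predU1P[->//|].
  move: P4; rewrite all_rcons => /andP[_ /allP P4].
  by case/orP=> /orP[];
     [move/allP: P1|move/allP: P2|move/allP: P3|move/P4 => //]; apply.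
have p2_nil : p2 != [::].
  by apply: contraTneq AU => p20; rewrite -last2 p20 properxx.
have p1_nil : p1 != [::].
  by apply: contraTneq LA => p10; rewrite -{2}last1 p10 properxx.
suff /acyclic : ucycle (hasse P) ((A :&: B) :: (p1 ++ p2) ++ rev (p3 ++ p4')).
  move=> /(_ cycP); rewrite /= !size_cat.
  rewrite ltnNge => /negP; apply; apply: leq_trans (leq_addr _ _).
  by apply: (@leq_add 1 1); rewrite lt0n size_eq0.
apply: (ucycle_of_two_paths (U := A :|: B)).
- by move=> C D; rewrite /hasse orbC.
- by apply: sub_path pathp => C D; rewrite /hasse => ->.
- by rewrite last_cat last1.
- by apply: sub_path pathq => C D; rewrite /hasse => ->.
- exact: up pathp.
- by have := up _ _ pathq; rewrite -rcons_cons rcons_uniq => /andP[].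
move=> C; rewrite !mem_cat negb_or => Cp; apply/andP; split; apply/negP => Cq.
- have /andP[LC CB] := proper_path_mem (pp _ _ path3) Cq; rewrite last3 in CB.
  case/orP: Cp => [C1|C2].
    have /andP[_] := proper_path_mem (pp _ _ path1) C1; rewrite last1 => CA.
    by move: LC; rewrite properE subsetI CA CB andbF.
  have /andP[/proper_sub AC _] := proper_path_mem (pp _ _ path2) C2.
  by move: nAB; rewrite (subset_trans AC CB).
have Cq' : C \in rcons p4' (A :|: B) by rewrite mem_rcons inE Cq orbT.
have /andP[/proper_sub BC CU] := proper_path_mem (pp _ _ path4) Cq'.
rewrite last4 in CU.
case/orP: Cp => [C1|C2].
  have /andP[_] := proper_path_mem (pp _ _ path1) C1; rewrite last1 => CA.
  by move: nBA; rewrite (subset_trans BC CA).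
have /andP[/proper_sub AC _] := proper_path_mem (pp _ _ path2) C2.
by have := U4 C Cq; rewrite eqEsubset CU subUset AC BC.
Qed.

(** An element of minimal size in a cycle of the Hasse diagram is covered by its
    two neighbours. These share a nonempty subset, hence are nested, which
    contradicts that both are covers. *)
Lemma laminar_tree (T : finType) (P : {set {set T}}) :
  setT \in P -> set0 \notin P -> laminar P -> is_tree P (hasse P).
Proof.
move=> PT P0 lam; split.
- by apply/set0Pn; exists setT.
- set e := [rel u w | [&& u \in P, w \in P & hasse P u w]].
  have syme : connect_sym e.
    by apply: sym_connect_sym => u w; rewrite /= /hasse orbC andbCA.
  have toT A : A \in P -> connect e A setT.
    move=> PA; have [->|AT] := eqVneq A setT; first exact: connect0.
    have [|p [pA pT pP]] := saturated_chain PA PT; first by rewrite properT.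
    apply/connectP; exists p => //; apply: sub_path pA => u w /= uw.
    by rewrite /hasse uw; case/and4P: uw => -> ->.
  move=> A B PA PB; apply: connect_trans (toT A PA) _.
  by rewrite syme toT.
move=> c cP /andP[Hc uc]; rewrite leqNgt; apply/negP => c3.
have [C Cc Cmin] : exists2 C, C \in c & forall D, D \in c -> #|C| <= #|D|.
  have x0 : head set0 c \in c by case: (c) c3 => //= x s _; exact: mem_head.
  by case: (arg_minnP (fun D : {set T} => #|D|) x0) => C Cc Cmin; exists C.
have [i s Es] := rot_to Cc.
have : path.cycle (hasse P) (C :: s) by rewrite -Es rot_cycle.
have : uniq (C :: s) by rewrite -Es rot_uniq.
have sc D : D \in C :: s -> D \in c by rewrite -Es mem_rot.
have : size (C :: s) > 2 by rewrite -Es size_rot.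
case/lastP: s {Es} sc => [//|s Z]; case: s => [//|Y s] sc _.
rewrite /= mem_rcons rcons_path last_rcons => /and3P[_ YZ _] /and3P[CY _ ZC].
have up D : D \in c -> hasse P C D || hasse P D C -> covers P C D.
  move=> Dc; rewrite /hasse [covers P D C || _]orbC orbb => /orP[//|].
  by move/covers_proper/proper_card; rewrite ltnNge Cmin.
have {CY} CY : covers P C Y.
  by apply: up; [apply: sc; rewrite !inE eqxx orbT | rewrite CY].
have {ZC} CZ : covers P C Z.
  apply: up; last by rewrite ZC orbT.
  by apply: sc; rewrite inE mem_rcons !inE eqxx !orbT.
have {YZ} YZ : Y != Z by apply: contraNneq YZ => ->; rewrite mem_head.
have no_chain D D' :
    covers P C D -> covers P C D' -> D \subset D' -> D != D' -> False.
  move=> /and4P[_ PD CD _] /and4P[_ PD' _ /existsP nD] DD' ne; apply: nD.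
  by exists D; rewrite PD CD properEneq ne.
have /and4P[PC PY /proper_sub CsY _] := CY.
have /and4P[_ PZ /proper_sub CsZ _] := CZ.
have : Y :&: Z != set0.
  apply: contraNneq P0 => YZ0; have : C \subset Y :&: Z by rewrite subsetI CsY.
  by rewrite YZ0 subset0 => /eqP <-.
case/(lam _ _ PY PZ)/orP => [/no_chain|/no_chain]; first exact.
by rewrite eq_sym; apply.
Qed.

(** * Crossing chords of a convex polygon *)

Section Geometry.

Import Order.TTheory GRing.Theory Num.Theory.
Local Open Scope ring_scope.

Lemma orient_affine (R : realFieldType) (a b p q : 'rV[R]_2) (t : R) :
  orient a b ((1 - t) *: p + t *: q) = (1 - t) * orient a b p + t * orient a b q.
Proof. by rewrite /orient !mxE; ring. Qed.

Lemma orient_on_line (R : realFieldType) (a b : 'rV[R]_2) (t : R) :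
  orient a b ((1 - t) *: a + t *: b) = 0.
Proof. by rewrite /orient !mxE; ring. Qed.

Lemma orient_swap (R : realFieldType) (a b c : 'rV[R]_2) :
  orient b a c = - orient a b c.
Proof. by rewrite /orient; ring. Qed.

Lemma orient_rot (R : realFieldType) (a b c : 'rV[R]_2) :
  orient b c a = orient a b c.
Proof. by rewrite /orient; ring. Qed.

Lemma orient_same (R : realFieldType) (a b : 'rV[R]_2) : orient a b a = 0.
Proof. by rewrite /orient; ring. Qed.

(** Each segment has its ends strictly on opposite sides of the line of the
    other one. The signed distance to that line is affine along the segment, and
    the intersection point is where it vanishes. *)
Lemma crossing_point (R : realFieldType) (a b c d : 'rV[R]_2) :
  orient a b c * orient a b d < 0 -> orient c d a * orient c d b < 0 ->
  exists t s : R, [/\ 0 < t < 1, 0 < s < 1 &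
    (1 - t) *: a + t *: b = (1 - s) *: c + s *: d].
Proof.
move=> ab cd.
have key (x y : R) : x * y < 0 -> x - y != 0 /\ 0 < x / (x - y) < 1.
  move=> xy; have ne : x - y != 0.
    apply: contraTneq xy => /eqP; rewrite subr_eq0 => /eqP ->.
    by rewrite -expr2 -leNgt sqr_ge0.
  split=> //; have p : 0 < (x - y) ^+ 2 by rewrite exprn_even_gt0.
  have -> : x / (x - y) = (x * (x - y)) / (x - y) ^+ 2 by field.
  rewrite divr_gt0 //=; last by nra.
  by rewrite ltr_pdivrMr // mul1r; nra.
have [n1 H1] := key _ _ ab; have [n2 H2] := key _ _ cd.
exists (orient c d a / (orient c d a - orient c d b)),
       (orient a b c / (orient a b c - orient a b d)); split=> //.
apply/rowP => j; rewrite !mxE.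
have [->|->] : j = 0 \/ j = 1.
  by case: j => [[|[|[]]] ?] //; [left|right]; apply: val_inj.
  by move: n1 n2; rewrite /orient => n1 n2; field; rewrite n1 n2.
by move: n1 n2; rewrite /orient => n1 n2; field; rewrite n1 n2.
Qed.

(** A factor sg of sign 1 or -1 lets clockwise and counterclockwise polygons be
    treated at once. *)
Lemma convex_polygon_sign (R : realFieldType) (m : nat) (v : 'I_m -> 'rV[R]_2) :
  convex_polygon v -> exists sg : R, forall i j k : 'I_m, (i < j < k)%N ->
    0 < sg * orient (v i) (v j) (v k).
Proof.
case=> H; [exists 1|exists (-1)] => i j k /H; first by rewrite mul1r.
by rewrite mulN1r oppr_gt0.
Qed.

Lemma segmentC (m : nat) (i j : 'I_m) : segment i j = segment j i.
Proof. by rewrite /segment setUC. Qed.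

Lemma in_open_segment_ordered (R : realFieldType) (m : nat) (v : 'I_m -> 'rV[R]_2)
    (i j : 'I_m) (p : 'rV[R]_2) : (i < j)%N -> in_open_segment v (segment i j) p ->
  exists2 t : R, 0 < t < 1 & p = (1 - t) *: v i + t *: v j.
Proof.
move=> ij [i' [j' [t [ne seg t01 ->]]]].
have : j' \in segment i j by rewrite seg !inE eqxx orbT.
have : i' \in segment i j by rewrite seg !inE eqxx.
rewrite !inE => /orP[]/eqP ei /orP[]/eqP ej; subst i' j'; rewrite ?eqxx // in ne.
  by exists t.
by exists (1 - t); [lra | rewrite subKr addrC].
Qed.

Lemma side_of_chord (R : realFieldType) (m : nat) (v : 'I_m -> 'rV[R]_2) (sg : R)
    (a b x : 'I_m) :
  (forall i j k : 'I_m, (i < j < k)%N -> 0 < sg * orient (v i) (v j) (v k)) ->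
  (a < b)%N ->
  [/\ (a < x < b)%N -> sg * orient (v a) (v b) (v x) < 0,
      (x == a) || (x == b) -> sg * orient (v a) (v b) (v x) = 0
    & ~~ (a <= x <= b)%N -> 0 < sg * orient (v a) (v b) (v x)].
Proof.
move=> Hsg ab; split.
- move=> axb; rewrite -orient_rot orient_swap -oppr_gt0 -mulrN opprK.
  by rewrite orient_rot Hsg.
- case/orP=> /eqP ->; first by rewrite orient_same mulr0.
  by rewrite -orient_rot -orient_rot orient_same mulr0.
- move=> nx; have [bx|xb] := ltnP b x; first by rewrite Hsg // ab.
  by rewrite -orient_rot -orient_rot Hsg //; move: nx; lia.
Qed.

(** A chord separates the vertices strictly between its ends from the others.
    If the ends do not alternate, the second chord stays weakly on one side of
    the line of the first one with an end strictly there, unless the chords are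
    equal, and so has no inner point on that line. *)
Lemma crossP (R : realFieldType) (m : nat) (v : 'I_m -> 'rV[R]_2)
    (a b c d : 'I_m) : convex_polygon v -> (a < b)%N -> (c < d)%N ->
  cross v (segment a b) (segment c d) <->
  (a < c)%N && (c < b)%N && (b < d)%N || (c < a)%N && (a < d)%N && (d < b)%N.
Proof.
move=> /convex_polygon_sign[sg Hsg] ab cd.
have [Sci Sce Sco] := side_of_chord c Hsg ab.
have [Sdi Sde Sdo] := side_of_chord d Hsg ab.
split.
  case=> ne [p [/(in_open_segment_ordered ab)[t t01 pt]
               /(in_open_segment_ordered cd)[s s01 ps]]].
  have e1 := orient_on_line (v a) (v b) t; rewrite -pt ps orient_affine in e1.
  have {}e1 : (1 - s) * (sg * orient (v a) (v b) (v c)) +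
              s * (sg * orient (v a) (v b) (v d)) = 0.
    by rewrite -[RHS](mulr0 sg) -e1; ring.
  apply/negPn/negP => Hni.
  have [[cE dE]|Hne] : (c = a /\ d = b) \/ ~~ ((c == a) && (d == b)).
    by case: eqP; case: eqP; auto.
    by case/eqP: ne; rewrite cE dE.
  have weak_out (x : 'I_m) : ~~ (a < x < b)%N -> 0 <= sg * orient (v a) (v b) (v x).
    have [_ Se So] := side_of_chord x Hsg ab.
    have [/Se -> //|ne_x nx] := boolP ((x == a) || (x == b)).
    by apply/ltW/So; move: ne_x nx; rewrite -!val_eqE /=; clear; lia.
  have weak_in (x : 'I_m) : (a <= x <= b)%N -> sg * orient (v a) (v b) (v x) <= 0.
    have [Si Se _] := side_of_chord x Hsg ab.
    have [/Se -> //|ne_x nx] := boolP ((x == a) || (x == b)).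
    by apply/ltW/Si; move: ne_x nx; rewrite -!val_eqE /=; clear; lia.
  (* Both ends of the second segment are weakly on the same side of the line   *)
  (* of the first one, and one of them strictly.                              *)
  have : [\/ ~~ (a <= c <= b)%N /\ ~~ (a < d < b)%N,
            ~~ (a <= d <= b)%N /\ ~~ (a < c < b)%N,
            (a < c < b)%N /\ (a <= d <= b)%N
          | (a < d < b)%N /\ (a <= c <= b)%N].
    have [ci|ci] := boolP (a < c < b)%N; have [di|di] := boolP (a < d < b)%N.
    - by apply: Or43; split=> //; clear -di; lia.
    - by apply: Or43; split=> //; clear -Hni ci di cd; lia.
    - by apply: Or44; split=> //; clear -Hni ci di cd; lia.
    have [ce|co] := boolP (a <= c <= b)%N; last exact: Or41.
    have [de|dn] := boolP (a <= d <= b)%N; last exact: Or42.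
    by move: Hne; rewrite -!val_eqE /=; clear -ci di ce de cd; lia.
  have /andP[s0 s1] := s01; have s1' : 0 < 1 - s by rewrite subr_gt0.
  have sum_gt0 (x y : R) : 0 < x -> 0 <= y -> x + y <> 0.
    by clear => x0 y0; lra.
  have sum_lt0 (x y : R) : x < 0 -> y <= 0 -> x + y <> 0.
    by clear => x0 y0; lra.
  case=> [[/Sco X Y]|[/Sdo Y X]|[/Sci X Y]|[/Sdi Y X]]; move: e1.
  - by apply: sum_gt0; [apply: mulr_gt0 | rewrite mulr_ge0 ?weak_out // ltW].
  - by rewrite addrC; apply: sum_gt0;
       [apply: mulr_gt0 | rewrite mulr_ge0 ?weak_out // ltW].
  - by apply: sum_lt0;
       [rewrite (pmulr_rlt0 _ s1') | rewrite (pmulr_rle0 _ s0) weak_in].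
  - by rewrite addrC; apply: sum_lt0;
       [rewrite (pmulr_rlt0 _ s0) | rewrite (pmulr_rle0 _ s1') weak_in].
have [Sai Sae Sao] := side_of_chord a Hsg cd.
have [Sbi Sbe Sbo] := side_of_chord b Hsg cd.
have opp x y : sg * x < 0 -> 0 < sg * y -> x * y < 0.
  move=> Hx Hy; rewrite ltNge; apply/negP => xy.
  have : (sg * x) * (sg * y) < 0 by rewrite nmulr_rlt0.
  by rewrite mulrACA -expr2 ltNge mulr_ge0 // sqr_ge0.
move=> Hint; split.
  apply/eqP => /setP/(_ c); rewrite !inE eqxx /= => /orP[]/eqP E;
    by move: Hint; rewrite E; clear; lia.
have [||t [s [t01 s01 E]]] :=
  crossing_point (a := v a) (b := v b) (c := v c) (d := v d).
- case/orP: Hint => H.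
  + by apply: opp; [apply: Sci | apply: Sdo]; clear -H; lia.
  + by rewrite mulrC; apply: opp; [apply: Sdi | apply: Sco]; clear -H; lia.
- case/orP: Hint => H.
  + by rewrite mulrC; apply: opp; [apply: Sbi | apply: Sao]; clear -H; lia.
  + by apply: opp; [apply: Sai | apply: Sbo]; clear -H; lia.
exists ((1 - t) *: v a + t *: v b); split.
  by exists a, b, t; split=> //; apply: contraTneq ab => ->; rewrite ltnn.
by exists c, d, s; split=> //; apply: contraTneq cd => ->; rewrite ltnn.
Qed.

End Geometry.

(** * Intervals of a permutation *)

(** Natural number bounds and a half-open range: iseg n a b is the set of values
    encoded by the edge (a, b). *)
Definition iseg (n a b : nat) : {set 'I_n} := [set x : 'I_n | a <= x < b].

Lemma irange_iseg (n : nat) (a b : 'I_n) : irange a b = iseg n a b.+1.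
Proof. by apply/setP => x; rewrite !inE. Qed.

Lemma consecutiveP (n : nat) (A : {set 'I_n}) :
  reflect (A != set0 /\
           forall x y z : 'I_n, x \in A -> y \in A -> x <= z <= y -> z \in A)
          (consecutive A).
Proof.
apply: (iffP existsP) => [[a /existsP[b /andP[ab /eqP ->]]]|[/set0Pn[x0 Ax0] cvx]].
  split; first by apply/set0Pn; exists a; rewrite inE leqnn.
  by move=> x y z; rewrite !inE; lia.
case: (arg_minnP (fun x : 'I_n => x : nat) Ax0) => a Aa amin.
case: (arg_maxnP (fun x : 'I_n => x : nat) Ax0) => b Ab bmax.
exists a; apply/existsP; exists b; rewrite amin //=.
apply/eqP/setP => x; rewrite inE; apply/idP/idP => [Ax|Hx].
  by rewrite amin //=; apply: bmax.
exact: cvx Hx.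
Qed.

Lemma consecutive_iseg (n a b : nat) : a < b -> b <= n -> consecutive (iseg n a b).
Proof.
move=> ab bn; apply/consecutiveP; split; last by move=> x y z; rewrite !inE; lia.
have an : a < n by lia.
by apply/set0Pn; exists (Ordinal an); rewrite inE /=; lia.
Qed.

Lemma consecutive_isegP (n : nat) (A : {set 'I_n}) : consecutive A ->
  exists a b, [/\ a < b, b <= n & A = iseg n a b].
Proof.
case/existsP => a /existsP[b /andP[ab /eqP ->]].
by exists a, b.+1; rewrite ltnS ltn_ord irange_iseg.
Qed.

Lemma consecutiveIU (n : nat) (A B : {set 'I_n}) :
  consecutive A -> consecutive B -> A :&: B != set0 ->
  consecutive (A :&: B) && consecutive (A :|: B).
Proof.
move=> /consecutiveP[A0 cA] /consecutiveP[_ cB] AB0; have /set0Pn[w] := AB0.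
rewrite inE => /andP[Aw Bw].
apply/andP; split; apply/consecutiveP; split=> //.
- move=> x y z; rewrite !inE => /andP[Ax Bx] /andP[Ay By] Hz.
  by rewrite (cA x y) // (cB x y).
- by apply/set0Pn; exists w; rewrite inE Aw.
move=> x y z; rewrite !inE => Hx Hy Hz; have [zw|wz] := leqP z w.
  have Hz' : x <= z <= w by lia.
  by case/orP: Hx => Hx; [rewrite (cA x w)|rewrite (cB x w) ?orbT].
have Hz' : w <= z <= y by lia.
by case/orP: Hy => Hy; [rewrite (cA w y)|rewrite (cB w y) ?orbT].
Qed.

Lemma disjoint_blocks_ordered (n : nat) (A B : {set 'I_n}) :
  consecutive A -> consecutive B -> [disjoint A & B] ->
  forall x x' y y', x \in A -> x' \in A -> y \in B -> y' \in B ->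
    x < y -> x' < y'.
Proof.
move=> /consecutiveP[_ cA] /consecutiveP[_ cB] dis x x' y y' Ax Ax' By By' xy.
rewrite ltnNge; apply/negP => yx.
have nAB z : z \in A -> z \in B -> False.
  by move=> Az Bz; move/disjointFl/(_ Bz): dis; rewrite Az.
have [xy'|yx'] := leqP x y'.
  by apply: (nAB y') => //; apply: (cA x x'); lia.
by apply: (nAB x) => //; apply: (cB y' y); lia.
Qed.

(** Otherwise an element of Z lies between elements of X and of Y, and an element
    of X between elements of Y and of Z. As the blocks are convex and disjoint,
    the whole block Z would lie between X and Y, and X between Y and Z. *)
Lemma three_blocks (n : nat) (X Y Z : {set 'I_n}) :
  consecutive X -> consecutive Y -> consecutive Z ->
  [disjoint X & Y] -> [disjoint Y & Z] -> [disjoint X & Z] ->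
  consecutive (X :|: Y :|: Z) ->
  consecutive (X :|: Y) || consecutive (Y :|: Z).
Proof.
move=> cX cY cZ dXY dYZ dXZ /consecutiveP[_ cU].
have between (A B : {set 'I_n}) :
    consecutive A -> consecutive B -> ~~ consecutive (A :|: B) ->
  exists a b c, [/\ a \in A, b \in B, c \notin A :|: B
                  & (a < c < b) || (b < c < a)].
  move=> /consecutiveP[/set0Pn[a0 Aa0] cA] /consecutiveP[_ cB] nAB.
  apply: contrapT => Hno; case/negP: nAB; apply/consecutiveP; split.
    by apply/set0Pn; exists a0; rewrite inE Aa0.
  move=> x y z Hx Hy Hz; apply/negPn/negP => nz.
  have [xz zy] : x < z /\ z < y.
    have neq w : w \in A :|: B -> (w : nat) <> z.
      by move=> Hw /val_inj wz; rewrite -wz Hw in nz.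
    by have := neq x Hx; have := neq y Hy; clear -Hz; lia.
  move: Hx Hy nz; rewrite !inE negb_or => /orP[Hx|Hx] /orP[Hy|Hy] /andP[nA nB].
  - by rewrite (cA x y) in nA.
  - by apply: Hno; exists x, y, z; rewrite !inE negb_or nA nB Hx Hy xz zy.
  - by apply: Hno; exists y, x, z; rewrite !inE negb_or nA nB Hx Hy xz zy orbT.
  - by rewrite (cB x y) in nB.
apply/negPn/negP; rewrite negb_or => /andP[nXY nYZ].
have [x [y [z [Xx Yy nz Hz]]]] := between _ _ cX cY nXY.
have [y' [z' [x' [Yy' Zz' nx' Hx']]]] := between _ _ cY cZ nYZ.
have Zz : z \in Z.
  have : z \in X :|: Y :|: Z.
    by case/orP: Hz => Hz; [apply: (cU x y)|apply: (cU y x)];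
      rewrite ?inE ?Xx ?Yy ?orbT //; clear -Hz; lia.
  by rewrite inE (negbTE nz).
have Xx' : x' \in X.
  have : x' \in X :|: Y :|: Z.
    by case/orP: Hx' => Hx'; [apply: (cU y' z')|apply: (cU z' y')];
      rewrite ?inE ?Yy' ?Zz' ?orbT //; clear -Hx'; lia.
  by rewrite -setUA inE (negbTE nx') orbF.
have XZ := disjoint_blocks_ordered cX cZ dXZ Xx Xx' Zz Zz'.
have YZ := disjoint_blocks_ordered cY cZ dYZ Yy Yy' Zz Zz'.
have XY := disjoint_blocks_ordered cX cY dXY Xx Xx' Yy Yy'.
rewrite disjoint_sym in dXY.
have YX := disjoint_blocks_ordered cY cX dXY Yy Yy' Xx Xx'.
rewrite disjoint_sym in dYZ.
have ZY := disjoint_blocks_ordered cZ cY dYZ Zz Zz' Yy Yy'.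
rewrite disjoint_sym in dXZ.
have ZX := disjoint_blocks_ordered cZ cX dXZ Zz Zz' Xx Xx'.
clear -Hz Hx' XZ YZ XY YX ZY ZX; lia.
Qed.

Lemma interval_setIU (n : nat) (s : 'S_n) (A B : {set 'I_n}) :
  is_interval s A -> is_interval s B -> A :&: B != set0 ->
  is_interval s (A :&: B) && is_interval s (A :|: B).
Proof.
move=> /andP[cA cpA] /andP[cB cpB] AB0.
have := consecutiveIU cA cB AB0 => /andP[cI cU].
have := consecutiveIU cpA cpB; rewrite -preimsetI -preimsetU.
case/(_ _)/andP; last by rewrite /is_interval cI cU => -> ->.
have /set0Pn[x ABx] := AB0; apply/set0Pn; exists (s^-1%g x).
by rewrite inE permKV.
Qed.

Lemma interval_of_three (n : nat) (s : 'S_n) (a b c d : nat) :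
  a < b -> b < c -> c < d -> d <= n ->
  is_interval s (iseg n a b) -> is_interval s (iseg n b c) ->
  is_interval s (iseg n c d) -> is_interval s (iseg n a d) ->
  is_interval s (iseg n a c) || is_interval s (iseg n b d).
Proof.
move=> ab bc cd dn /andP[_ cX] /andP[_ cY] /andP[_ cZ] /andP[_ cU].
rewrite /is_interval !consecutive_iseg /=; try lia.
have segU x y z : x < y -> y < z -> iseg n x z = iseg n x y :|: iseg n y z.
  by move=> xy yz; apply/setP => i; rewrite !inE; lia.
have dis x y z w : y <= z -> [disjoint s @^-1: iseg n x y & s @^-1: iseg n z w].
  move=> yz; apply/pred0P => i /=; rewrite !inE; lia.
rewrite !(segU a b c, segU b c d) // !preimsetU.
apply: three_blocks => //; try exact: dis.
  by apply: dis; lia.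
by rewrite -!preimsetU -!segU //; lia.
Qed.

(** s x is the rank of the key of x. *)
Lemma perm_of_keys (n : nat) (r : 'I_n -> nat) : injective r ->
  exists s : 'S_n, forall x y, (s x < s y) = (r x < r y).
Proof.
move=> r_inj; pose below x := [set y | r y < r x].
have below_lt x : #|below x| < n.
  rewrite -[X in _ < X]card_ord; apply: proper_card.
  by apply/properP; split; [apply/subsetP | exists x; rewrite ?inE ?ltnn].
have mono x y : r x < r y -> #|below x| < #|below y|.
  move=> xy; apply: proper_card; apply/properP; split.
    by apply/subsetP => z; rewrite !inE => /ltn_trans; apply.
  by exists x; rewrite inE ?ltnn.
pose pos x := Ordinal (below_lt x).
have posE x y : (pos x < pos y) = (r x < r y).
  apply/idP/idP => [|/mono //]; rewrite /= !ltnNge; apply: contra.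
  by rewrite leq_eqVlt => /predU1P[/r_inj -> //|/mono/ltnW].
have pos_inj : injective pos.
  move=> x y e; apply: r_inj; have := posE x y; have := posE y x.
  by rewrite e ltnn; case: ltngtP.
by exists (perm pos_inj) => x y; rewrite !permE posE.
Qed.

Lemma perm_realising (n : nat) (E : rel nat) : edge_system n E ->
  exists s : 'S_n, forall a b, a < b -> b <= n ->
    is_interval s (iseg n a b) = E a b.
Proof.
move=> ES; have [r [r_inj r_cvx _]] := realisation_exists true ES (edge_full ES).
have [|s sE] := @perm_of_keys n (fun x => r x).
  by move=> x y /r_inj e; apply/val_inj/e; rewrite !ltn_ord.
(* s maps values to positions, whereas intervals are defined for the map from *)
(* positions to values.                                                       *)
exists (s^-1)%g => a b ab bn; rewrite /is_interval consecutive_iseg //=.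
have le_s x y : (s x <= s y) = (r x <= r y) by rewrite leqNgt sE -leqNgt.
apply/consecutiveP/idP => [[_ cvx]|/r_cvx].
  apply/r_cvx => // x y z Hx Hy Hz Hr.
  have xn : x < n by lia. have yn : y < n by lia. have zn : z < n by lia.
  have := cvx (s (Ordinal xn)) (s (Ordinal yn)) (s (Ordinal zn)).
  by rewrite !inE !permK !le_s /=; apply; rewrite ?Hx ?Hy //; lia.
move=> /(_ (leq0n a) ab bn) cvx; split.
  have an : a < n by lia.
  by apply/set0Pn; exists (s (Ordinal an)); rewrite !inE permK /=; lia.
move=> x y z; rewrite -[x](permKV s) -[y](permKV s) -[z](permKV s).
move: (s^-1 x)%g (s^-1 y)%g (s^-1 z)%g => {}x {}y {}z.
rewrite !inE !permK !le_s => Hx Hy Hz.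
have [-> //|zx] := eqVneq z x; have [-> //|zy] := eqVneq z y.
have rzx : r z <> r x.
  by move/r_inj => e; case/eqP: zx; apply/val_inj/e; rewrite !ltn_ord.
have rzy : r z <> r y.
  by move/r_inj => e; case/eqP: zy; apply/val_inj/e; rewrite !ltn_ord.
by apply: (cvx x y z) => //; [rewrite ltn_ord | clear -Hz rzx rzy; lia].
Qed.

(** * Edges of a dissection and the map Phi *)

Definition edge (n : nat) (D : {set {set 'I_n.+1}}) (a b : nat) : bool :=
  [&& a < b, b <= n & segment (inord a) (inord b) \in dissection_graph D].

Lemma segment_inj (m : nat) (i j k l : 'I_m) : i < j -> k < l ->
  segment i j = segment k l -> i = k /\ j = l.
Proof.
move=> ij kl e.
have : j \in segment k l by rewrite -e !inE eqxx orbT.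
have : i \in segment k l by rewrite -e !inE eqxx.
have : k \in segment i j by rewrite e !inE eqxx.
have : l \in segment i j by rewrite e !inE eqxx orbT.
rewrite !inE -!val_eqE /= => ? ? ? ?; split; apply: val_inj => /=; lia.
Qed.

Lemma edgeE (n : nat) (D : {set {set 'I_n.+1}}) (i j : 'I_n.+1) : i < j ->
  edge D i j = (segment i j \in dissection_graph D).
Proof. by move=> ij; rewrite /edge ij !inord_val -ltnS ltn_ord. Qed.

Lemma outer_edgeE (n a b : nat) : a < b -> b <= n ->
  (segment (inord a) (inord b : 'I_n.+1) \in outer_edges n.+1) =
  (b == a.+1) || (a == 0) && (b == n).
Proof.
move=> ab bn; apply/imsetP/idP => [[i _ e]|].
  have [iS|iS] := ltnP i.+1 n.+1.
    have [||ei ej] := @segment_inj _ _ _ _ _ _ _ e.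
    - by rewrite !inordK //; lia.
    - by rewrite /= modn_small.
    have := congr1 val ei; have := congr1 val ej.
    by rewrite /= modn_small // !inordK; lia.
  have iE : (i : nat) = n by have := ltn_ord i; lia.
  rewrite [segment i _]segmentC in e.
  have [||ei ej] := @segment_inj _ _ _ _ _ _ _ (esym e).
  - by rewrite /= iE modnn; lia.
  - by rewrite !inordK //; lia.
  have := congr1 val ei; have := congr1 val ej.
  by rewrite /= iE modnn !inordK; lia.
case/orP=> [/eqP bE|/andP[/eqP -> /eqP ->]].
  exists (inord a) => //; congr segment; apply: val_inj.
  by rewrite /= !inordK ?modn_small; lia.
exists ord_max => //; rewrite segmentC; congr segment; apply: val_inj.
  by rewrite /= inordK.
by rewrite /= inordK ?modnn.
Qed.

Lemma diagonal_ordered (n : nat) (d : {set 'I_n.+1}) : d \in diagonals n.+1 ->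
  exists i j : 'I_n.+1, i < j /\ d = segment i j.
Proof.
rewrite inE => /andP[/cards2P[i [j [ij ->]]] _].
have [lt|lt|/val_inj e] := ltngtP i j; last by rewrite e eqxx in ij.
  by exists i, j.
by exists j, i; rewrite [segment j i]segmentC.
Qed.

Lemma edge_diagonal (n : nat) (D : {set {set 'I_n.+1}}) (a b : nat) :
  edge D a b ->
  ~~ ((b == a.+1) || (a == 0) && (b == n)) -> segment (inord a) (inord b) \in D.
Proof. by case/and3P=> ab bn; rewrite inE outer_edgeE // => /orP[->|]. Qed.

Lemma dissection_determined (n : nat) (D D' : {set {set 'I_n.+1}}) :
  D \subset diagonals n.+1 -> D' \subset diagonals n.+1 -> edge D =2 edge D' ->
  D = D'.
Proof.
have half (D1 D2 : {set {set 'I_n.+1}}) : D1 \subset diagonals n.+1 ->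
    edge D1 =2 edge D2 -> D1 \subset D2.
  move=> /subsetP sD eD; apply/subsetP => d Dd; have dd := sD d Dd.
  have [i [j [ij dE]]] := diagonal_ordered dd.
  have : edge D1 i j by rewrite edgeE // -dE inE Dd orbT.
  rewrite eD edgeE // -dE inE => /orP[dout|//].
  by move: dd; rewrite inE dout andbF.
move=> sD sD' e; apply/eqP; rewrite eqEsubset.
by apply/andP; split; apply: half => // a b; rewrite e.
Qed.

(** Phi discards the outer edge given by the full interval and ignores the
    singletons, but the outer edges are put back in the graph of Phi P. *)
Lemma edge_Phi (n : nat) (P : {set {set 'I_n}}) :
  0 < n -> (forall a, a < n -> iseg n a a.+1 \in P) -> iseg n 0 n \in P ->
  forall a b, edge (Phi P) a b = [&& a < b, b <= n & iseg n a b \in P].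
Proof.
move=> n0 Pside Pfull a b; rewrite /edge.
case ab: (a < b) => //=; case bn: (b <= n) => //=.
rewrite [LHS]inE outer_edgeE //; case: (boolP ((b == a.+1) || _)) => /= [|nouter].
  case/orP=> [/eqP ->|/andP[/eqP -> /eqP ->] //].
  by rewrite Pside //; lia.
have Hd : segment (inord a) (inord b) \in diagonals n.+1.
  rewrite inE outer_edgeE // nouter andbT; apply/cards2P.
  exists (inord a), (inord b); split=> //.
  by rewrite -val_eqE /= !inordK; lia.
rewrite inE Hd inE /=.
apply/existsP/idP => [[a' /existsP[b' /and3P[ab' Pab /eqP e]]]|Pab].
  have [||ea eb] := @segment_inj _ _ _ _ _ _ _ e.
  - by rewrite !inordK; lia.
  - by rewrite /= /bump /=; lia.
  have := congr1 val ea; have := congr1 val eb; rewrite /= /bump /= !inordK; try lia.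
  by rewrite add1n => -> ->; rewrite -irange_iseg.
have an : a < n by lia. have bn' : b.-1 < n by lia.
exists (Ordinal an); apply/existsP; exists (Ordinal bn').
rewrite irange_iseg /= prednK; last by lia.
rewrite Pab; apply/and3P; split=> //; first by lia.
apply/eqP; congr segment; apply: val_inj; rewrite /= inordK /bump /=; lia.
Qed.

Lemma interval_poset_side (n : nat) (s : 'S_n) (a : nat) : a < n ->
  iseg n a a.+1 \in interval_poset s.
Proof.
move=> an; rewrite inE /is_interval consecutive_iseg //=.
apply/consecutiveP; split.
  by apply/set0Pn; exists (s^-1%g (Ordinal an)); rewrite !inE permKV /= leqnn ltnSn.
move=> x y z; rewrite !inE => Hx Hy; have /perm_inj -> : s x = s y.
  by apply: val_inj => /=; lia.
move=> Hz; have -> // : z = y by apply: val_inj => /=; lia.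
Qed.

Lemma interval_poset_setT (n : nat) (s : 'S_n) : 0 < n -> setT \in interval_poset s.
Proof.
move=> n0; have cT : consecutive [set: 'I_n].
  apply/consecutiveP; split=> [|x y z _ _ _]; last by rewrite inE.
  by apply/set0Pn; exists (Ordinal n0); rewrite inE.
by rewrite inE /is_interval preimsetT cT.
Qed.

Lemma iseg_full (n : nat) : iseg n 0 n = setT.
Proof. by apply/setP => x; rewrite !inE ltn_ord. Qed.

Lemma edge_Phi_interval_poset (n : nat) (s : 'S_n) (a b : nat) : 0 < n ->
  edge (Phi (interval_poset s)) a b =
  [&& a < b, b <= n & iseg n a b \in interval_poset s].
Proof.
move=> n0; apply: edge_Phi => //; first exact: interval_poset_side.
by rewrite iseg_full interval_poset_setT.
Qed.

Lemma Phi_sub_diagonals (n : nat) (P : {set {set 'I_n}}) :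
  Phi P \subset diagonals n.+1.
Proof. exact: subsetIl. Qed.

Lemma Phi_injective (n : nat) (s s' : 'S_n) : 0 < n ->
  Phi (interval_poset s) = Phi (interval_poset s') ->
  interval_poset s = interval_poset s'.
Proof.
move=> n0 e.
have half (s1 s2 : 'S_n) : Phi (interval_poset s1) = Phi (interval_poset s2) ->
    interval_poset s1 \subset interval_poset s2.
  move=> e12; apply/subsetP => A; rewrite inE => /[dup] IA /andP[cA _].
  have [a [b [ab bn AE]]] := consecutive_isegP cA.
  have : edge (Phi (interval_poset s1)) a b.
    by rewrite (edge_Phi_interval_poset _ _ _ n0) ab bn -AE inE.
  by rewrite e12 (edge_Phi_interval_poset _ _ _ n0) ab bn -AE.
apply/eqP; rewrite eqEsubset.
by rewrite (half s s' e) (half s' s (esym e)).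
Qed.

Lemma interval_poset_laminar (n : nat) (s : 'S_n) :
  is_tree (interval_poset s) (hasse (interval_poset s)) ->
  laminar (interval_poset s).
Proof.
move/tree_laminar; apply=> A B; rewrite !inE; exact: interval_setIU.
Qed.

Lemma laminar_iseg (n : nat) (P : {set {set 'I_n}}) (a b c d : nat) :
  laminar P -> iseg n a b \in P -> iseg n c d \in P ->
  a < c -> c < b -> b < d -> d <= n -> False.
Proof.
move=> lam Pab Pcd ac cb bd dn.
have an : a < n by lia. have cn : c < n by lia. have bn : b < n by lia.
have /orP[/subsetP H|/subsetP H] : (iseg n a b \subset iseg n c d) ||
    (iseg n c d \subset iseg n a b).
  apply: lam => //; apply/set0Pn; exists (Ordinal cn); rewrite !inE /=; lia.
- by have := H (Ordinal an); rewrite !inE /=; lia.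
- by have := H (Ordinal bn); rewrite !inE /=; lia.
Qed.

Lemma Phi_noncrossing (R : realFieldType) (n : nat) (v : 'I_n.+1 -> 'rV[R]_2)
    (s : 'S_n) : convex_polygon v -> 0 < n -> laminar (interval_poset s) ->
  noncrossing v (Phi (interval_poset s)).
Proof.
move=> hv n0 lam d e Pd Pe.
have sub := subsetP (Phi_sub_diagonals (interval_poset s)).
have [i [j [ij dE]]] := diagonal_ordered (sub d Pd).
have [k [l [kl eE]]] := diagonal_ordered (sub e Pe).
have memP (x y : 'I_n.+1) : x < y -> segment x y \in Phi (interval_poset s) ->
    iseg n x y \in interval_poset s.
  move=> xy Hxy; have : edge (Phi (interval_poset s)) x y.
    by rewrite edgeE // inE Hxy orbT.
  by rewrite edge_Phi_interval_poset // => /and3P[].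
rewrite {}dE {}eE in Pd Pe *; have Pij := memP _ _ ij Pd; have Pkl := memP _ _ kl Pe.
rewrite (crossP hv ij kl); have jn := ltn_ord j; have ln := ltn_ord l.
case/orP=> /andP[/andP[H1 H2] H3].
- exact: (laminar_iseg lam Pij Pkl).
- exact: (laminar_iseg lam Pkl Pij).
Qed.

Lemma Phi_quad_free (n : nat) (s : 'S_n) : 0 < n ->
  quad_free (Phi (interval_poset s)).
Proof.
move=> n0 a b c d; apply/negP => /and5P[ab bc cd Eab /and5P[Ebc Ecd Ead nac nbd]].
have ac := ltn_trans ab bc; have bd := ltn_trans bc cd; have ad := ltn_trans ac cd.
have dn := ltn_ord d; rewrite ltnS in dn.
move: Eab Ebc Ecd Ead nac nbd; rewrite -!edgeE // !edge_Phi_interval_poset //.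
rewrite ab bc cd ac bd ad dn (ltnW (leq_trans cd dn)).
rewrite (ltnW (leq_trans bd dn)) /= !inE => Iab Ibc Icd Iad nac nbd.
have := interval_of_three ab bc cd dn Iab Ibc Icd Iad.
by rewrite (negbTE nac) (negbTE nbd).
Qed.

(** * Dissections as edge systems and the bijection *)

Lemma dissection_edge_system (R : realFieldType) (n : nat)
    (v : 'I_n.+1 -> 'rV[R]_2) (D : {set {set 'I_n.+1}}) :
  convex_polygon v -> 0 < n -> noncrossing v D -> quad_free D ->
  edge_system n (edge D).
Proof.
move=> hv n0 nc qf; split.
- by move=> a b /and3P[-> ->].
- move=> a an; rewrite /edge ltnSn an inE outer_edgeE ?eqxx //.
- by rewrite /edge n0 leqnn inE outer_edgeE ?eqxx ?orbT.
- move=> a b c d Eab Ecd ac cb; apply/negP => bd.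
  have /and3P[ab bn _] := Eab; have /and3P[cd dn _] := Ecd.
  have Dab : segment (inord a) (inord b) \in D.
    by apply: edge_diagonal Eab _; clear -ac cb bd dn; lia.
  have Dcd : segment (inord c) (inord d) \in D.
    by apply: edge_diagonal Ecd _; clear -ac cb bd dn; lia.
  apply: (nc _ _ Dab Dcd); apply/(crossP hv); rewrite !inordK; lia.
- move=> a b c d Eab Ebc Ecd Ead; apply/negPn/negP; rewrite negb_or.
  move=> /andP[nac nbd].
  have /and3P[ab _ Sab] := Eab; have /and3P[bc _ Sbc] := Ebc.
  have /and3P[cd dn Scd] := Ecd; have /and3P[_ _ Sad] := Ead.
  have ac := ltn_trans ab bc; have bd := ltn_trans bc cd.
  have cn := ltnW (leq_trans cd dn).
  have /negP := qf (inord a) (inord b) (inord c) (inord d); apply.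
  rewrite /quadrilateral Sab Sbc Scd Sad.
  have lt_n x : x <= c -> x < n.+1 by move=> xc; rewrite ltnS (leq_trans xc).
  rewrite (inordK dn) !(inordK (lt_n _ _)) ?ab ?bc ?cd ?(ltnW ac) ?(ltnW bc) //=.
  by move: nac nbd; rewrite /edge ac bd cn dn /= => -> ->.
Qed.

Lemma edge_system_laminar (n : nat) (E : rel nat) (s : 'S_n) :
  edge_system n E ->
  (forall a b, a < b -> b <= n -> is_interval s (iseg n a b) = E a b) ->
  laminar (interval_poset s).
Proof.
move=> ES sE A B; rewrite !inE => IA IB.
have [a [b [ab bn AE]]] := consecutive_isegP (andP IA).1.
have [c [d [cd dn BE]]] := consecutive_isegP (andP IB).1.
have Eab : E a b by rewrite -sE // -AE.
have Ecd : E c d by rewrite -sE // -BE.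
rewrite {}AE {}BE {IA IB} => /set0Pn[x]; rewrite !inE => Hx.
have H1 := edge_noncrossing ES Eab Ecd; have H2 := edge_noncrossing ES Ecd Eab.
have [H|H] : (c <= a) && (b <= d) \/ (a <= c) && (d <= b) by clear -H1 H2 Hx; lia.
  by apply/orP; left; apply/subsetP => y; rewrite !inE; clear -H; lia.
by apply/orP; right; apply/subsetP => y; rewrite !inE; clear -H; lia.
Qed.

Theorem theorem4p1 (R : realFieldType) (n : nat) (v : 'I_n.+1 -> 'rV[R]_2)
    (hn : (2 <= n)%N) (hv : convex_polygon v) :
  [/\ {in tree_interval_posets n &, injective (@Phi n)},
      [set Phi P | P in tree_interval_posets n] = nc_quad_free_dissections v
    & #|tree_interval_posets n| = #|nc_quad_free_dissections v| ].
Proof.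
have n0 : 0 < n by apply: leq_trans hn.
have Phi_inj : {in tree_interval_posets n &, injective (@Phi n)}.
  move=> P Q; rewrite !inE => /andP[/existsP[s /eqP ->] _].
  move=> /andP[/existsP[s' /eqP ->] _].
  exact: Phi_injective.
suff Phi_im : [set Phi P | P in tree_interval_posets n] = nc_quad_free_dissections v.
  by split=> //; rewrite -Phi_im card_in_imset.
apply/setP => D; apply/imsetP/idP => [[P]|].
  rewrite !inE => /andP[/existsP[s /eqP ->] /asboolP tree] ->.
  rewrite Phi_sub_diagonals; apply/asboolP; split; last exact: Phi_quad_free.
  exact/Phi_noncrossing/interval_poset_laminar.
rewrite inE => /andP[sD /asboolP[nc qf]].
have ES := dissection_edge_system hv n0 nc qf.
have [s sE] := perm_realising ES.
exists (interval_poset s).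
  rewrite inE; apply/andP; split; first by apply/existsP; exists s.
  apply/asboolP/laminar_tree; first exact: interval_poset_setT.
    by rewrite inE; apply/negP => /andP[/consecutiveP[]]; rewrite eqxx.
  exact: edge_system_laminar sE.
apply: dissection_determined => //; first exact: Phi_sub_diagonals.
move=> a b; rewrite edge_Phi_interval_poset // inE.
case ab: (a < b); last by rewrite /edge ab.
case bn: (b <= n); last by rewrite /edge ab bn.
by rewrite /= sE.
Qed.
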